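(* Let $S$ be a smooth surface without boundary in $\mathbb{R}^3$ with position vector $\boldsymbol{x}$. Let $\boldsymbol{\xi}^{(1)}$ be a smooth vector field on $S$ such that $\boldsymbol{x}+2t\boldsymbol{\xi}^{(1)}$ is a first-order flex of $S$ which is tangent to the set of all nonrigid smooth surfaces. Then the first-order flex $\boldsymbol{x}+2t\boldsymbol{\xi}^{(1)}$ can be extended to a second-order flex of $S$, i.e., there exists a smooth vector field $\boldsymbol{\xi}^{(2)}$ on $S$ such that $\boldsymbol{x}+2t\boldsymbol{\xi}^{(1)}+2t^2\boldsymbol{\xi}^{(2)}$ is a second-order flex of $S$.
   Context: A smooth vector field on a surface $S\subset\mathbb{R}^3$ means here a smooth $\mathbb{R}^3$-valued map on $S$ (not necessarily tangent to $S$). Products of differentials of $\mathbb{R}^3$-valued maps are taken with respect to the scalar product $\cdot$ of $\mathbb{R}^3$ and are symmetric quadratic forms: in local coordinates $u,v$ on $S$, $d\boldsymbol{a}\,d\boldsymbol{b}=(\boldsymbol{a}_u\,du+\boldsymbol{a}_v\,dv)\cdot(\boldsymbol{b}_u\,du+\boldsymbol{b}_v\,dv)$. **$n$th-order flex.** Let $S$ be a smooth surface without boundary in $\mathbb{R}^3$ with position vector $\boldsymbol{x}$, let $n$ be a positive integer, and let $\boldsymbol{\xi}^{(1)},\dots,\boldsymbol{\xi}^{(n)}$ be smooth vector fields on $S$. The deformation $\boldsymbol{x}_t=\boldsymbol{x}+2t\boldsymbol{\xi}^{(1)}+2t^2\boldsymbol{\xi}^{(2)}+\dots+2t^n\boldsymbol{\xi}^{(n)}$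 is an $n$th-order flex of $S$ if the change in the length of any smooth curve on $S$ is $o(t^n)$ as $t\to 0$. In terms of first quadratic forms this condition reads $d\boldsymbol{x}_t^2-d\boldsymbol{x}^2=o(t^n)$. Thus $\boldsymbol{x}+2t\boldsymbol{\xi}^{(1)}$ is a first-order flex of $S$ if and only if $d\boldsymbol{x}\,d\boldsymbol{\xi}^{(1)}=0$, i.e. in local coordinates $\boldsymbol{x}_u\cdot\boldsymbol{\xi}^{(1)}_u=0$, $\boldsymbol{x}_u\cdot\boldsymbol{\xi}^{(1)}_v+\boldsymbol{x}_v\cdot\boldsymbol{\xi}^{(1)}_u=0$, $\boldsymbol{x}_v\cdot\boldsymbol{\xi}^{(1)}_v=0$; and $\boldsymbol{x}+2t\boldsymbol{\xi}^{(1)}+2t^2\boldsymbol{\xi}^{(2)}$ is a second-order flex of $S$ if and only if $d\boldsymbol{x}\,d\boldsymbol{\xi}^{(1)}=0$ and $d\boldsymbol{x}\,d\boldsymbol{\xi}^{(2)}+d\boldsymbol{\xi}^{(1)}\,d\boldsymbol{\xi}^{(1)}=0$. Such a second-order flex is called an extension of the first-order flex $\boldsymbol{x}+2t\boldsymbol{\xi}^{(1)}$. **Nonrigid surfaces.** A first-order flex of $S$ is trivial if it is generated by a smooth family of isometries of $\mathbb{R}^3$ (i.e. $2\boldsymbol{\xi}^{(1)}=\frac{d}{dt}\big|_{t=0}\varphi_t(\boldsymbol{x})$ for a smooth family $\varphi_t$ of isometries of $\mathbb{R}^3$ with $\varphi_0=\mathrm{id}$). $S$ is first-order rigid if every first-order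 flex of $S$ is trivial; otherwise $S$ is first-order nonrigid (briefly, nonrigid). **Tangency to the set of nonrigid surfaces.** Let $S$ be a smooth surface without boundary in $\mathbb{R}^3$ with position vector $\boldsymbol{x}$. A first-order flex $\boldsymbol{x}+2t\boldsymbol{\xi}^{(1)}$ of $S$ is tangent to the set of all nonrigid smooth surfaces if the following two conditions hold: (i) there is a smooth family $\{S(r)\}_{r\in(-1,1)}$ of nonrigid smooth surfaces without boundary in $\mathbb{R}^3$ such that $S(0)=S$, i.e. $\boldsymbol{x}(0)=\boldsymbol{x}$, where $\boldsymbol{x}(r)$ is the position vector of $S(r)$ (the position vectors $\boldsymbol{x}(r)$ are regarded as maps on a common parameter surface, smooth jointly in the point and in $r$); (ii) there is a smooth family $\{2\boldsymbol{\xi}^{(1)}(r)\}_{r\in(-1,1)}$ of vector fields ($\boldsymbol{\xi}^{(1)}(r)$ being a vector field on $S(r)$, likewise regarded as an $\mathbb{R}^3$-valued map on the common parameter surface, smooth jointly in the point and in $r$) such that, for every $r\in(-1,1)$, $\boldsymbol{x}(r)+2t\boldsymbol{\xi}^{(1)}(r)$ is a first-order flex of $S(r)$, and $$\frac{d}{dr}\Big|_{r=0}\boldsymbol{x}(r)=2\boldsymbol{\xi}^{(1)}(0)\qquad\text{and}\qquad \boldsymbol{\xi}^{(1)}(0)=\boldsymbol{\xi}^{(1)}.$$ *)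

(* Defs.v *)
From HB Require Import structures.
From mathcomp Require Import all_boot all_order all_algebra.
From mathcomp Require Import all_classical all_reals all_analysis.
Import Order.TTheory GRing.Theory Num.Theory.
Import numFieldNormedType.Exports.

Set Implicit Arguments.
Unset Strict Implicit.
Unset Printing Implicit Defensive.

Local Open Scope classical_set_scope.
Local Open Scope ring_scope.

(* C^k maps on an open set U; only the germs of f at points of U matter.  For
   finite-dimensional E, asking that all iterated directional derivatives exist
   and are continuous is the usual notion. *)
Fixpoint Ck (R : realType) (E F : normedModType R) (k : nat)
    (U : set E) (f : E -> F) : Prop :=
  match k with
  | 0 => forall p, U p -> {for p, continuous f}
  | k'.+1 => (forall p, U p -> differentiable f p) /\
             (forall v : E, Ck k' U (fun p => 'D_v f p))
  end.

Definition smooth_on (R : realType) (E F : normedModType R)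
    (U : set E) (f : E -> F) : Prop :=
  forall k, Ck k U f.

(* A chart of a topological surface, given together with its inverse
   parametrization.  [par] is only meaningful on [dom], [coord] only on the
   open set [par @` dom].  Chart domains are open in the whole plane: there is
   no boundary. *)
Record chart (R : realType) (T : topologicalType) := Chart {
  dom : set 'rV[R]_2;
  par : 'rV[R]_2 -> T;
  coord : T -> 'rV[R]_2;
  dom_open : open dom;
  im_open : open (par @` dom);
  par_continuous : forall u, dom u -> {for u, continuous par};
  coord_continuous : forall p, (par @` dom) p -> {for p, continuous coord};
  parK : forall u, dom u -> coord (par u) = u }.

Definition smooth_transition (R : realType) (T : topologicalType)
    (c d : chart R T) : Prop :=
  smooth_on (dom c `&` par c @^-1` (par d @` dom d)) (coord d \o par c).

(* Smooth two-dimensional manifolds without boundary, used as parameter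
   surfaces. *)
Record surface (R : realType) := Surface {
  points :> topologicalType;
  atlas : set (chart R points);
  surface_hausdorff : hausdorff_space points;
  surface_second_countable : @second_countable points;
  atlas_cover : forall p : points, exists2 c, atlas c & (par c @` dom c) p;
  atlas_smooth : forall c d, atlas c -> atlas d -> smooth_transition c d }.

Section SurfacesInSpace.
Variables (R : realType) (M : surface R).
Local Notation E3 := 'rV[R]_3.

(* The canonical norm on row vectors is the sup norm. *)
Definition enorm (v : E3) : R := Num.sqrt (\sum_i v 0 i ^+ 2).

Definition smooth_field (f : M -> E3) : Prop :=
  forall c, atlas c -> smooth_on (dom c) (f \o par c).

(* x is the position vector of a smooth surface in space parametrized by M:
   a smooth immersion.  Self-intersections are allowed; a surface that is a
   subset S of space is the case M = S with x the inclusion. *)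
Definition position_vector (x : M -> E3) : Prop :=
  smooth_field x /\
  forall c u, atlas c -> dom c u ->
    forall v : 'rV[R]_2, 'D_v (x \o par c) u = 0 -> v = 0.

(* Joint smoothness in r in ]-1, 1[ and in the point of M. *)
Definition smooth_family (f : R -> M -> E3) : Prop :=
  forall c, atlas c ->
    @smooth_on R (R * 'rV[R]_2)%type E3 (`]-1, 1[ `*` dom c)
      (fun z : R * 'rV[R]_2 => f z.1 (par c z.2)).

(* Smooth curves [a, b] -> M, smoothness on the closed interval meaning
   smoothness on some open set containing it. *)
Definition smooth_curve (a b : R) (gamma : R -> M) : Prop :=
  exists2 O : set R, open O & `[a, b] `<=` O /\
    (forall s, O s -> {for s, continuous gamma}) /\
    (forall c, atlas c ->
      @smooth_on R R 'rV[R]_2 (O `&` gamma @^-1` (par c @` dom c)) (coord c \o gamma)).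

Definition curve_length (a b : R) (c : R -> E3) : R :=
  \int[lebesgue_measure]_(s in `[a, b]) enorm (derive1 c s).

(* x_t = x + 2 t xi^(1) + ... + 2 t^n xi^(n); the vector field xi^(i+1) is
   the entry of index i of the tuple. *)
Definition deformation n (x : M -> E3) (xi : n.-tuple (M -> E3))
    (t : R) : M -> E3 :=
  fun p => x p + \sum_(i < n) (2 * t ^+ i.+1) *: tnth xi i p.

Definition flex n (x : M -> E3) (xi : n.-tuple (M -> E3)) : Prop :=
  (forall i, smooth_field (tnth xi i)) /\
  forall (a b : R) (gamma : R -> M), a <= b -> smooth_curve a b gamma ->
    (fun t => curve_length a b (deformation x xi t \o gamma)
              - curve_length a b (x \o gamma))
    =o_ (0 : R) (fun t => t ^+ n).

Definition isometry_family (e : R) (phi : R -> E3 -> E3) : Prop :=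
  @smooth_on R (R * E3)%type E3 (`]-e, e[ `*` [set: E3]) (fun z : R * E3 => phi z.1 z.2) /\
  forall t, t \in `]-e, e[ ->
    forall p q, enorm (phi t p - phi t q) = enorm (p - q).

Definition trivial_flex (x xi : M -> E3) : Prop :=
  exists (e : R) (phi : R -> E3 -> E3),
    [/\ 0 < e, isometry_family e phi, (forall p, phi 0 p = p) &
        forall p : M, is_derive (0 : R) 1 (fun t => phi t (x p)) (2 *: xi p)].

Definition rigid (x : M -> E3) : Prop :=
  forall xi : M -> E3, flex x [tuple xi] -> trivial_flex x xi.

Definition nonrigid (x : M -> E3) : Prop := ~ rigid x.

Definition tangent_to_nonrigid (x xi : M -> E3) : Prop :=
  exists X Xi : R -> M -> E3,
    [/\ smooth_family X,
        (forall r, r \in `]-1, 1[ -> position_vector (X r) /\ nonrigid (X r)) &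
        X 0 = x] /\
    [/\ smooth_family Xi,
        (forall r, r \in `]-1, 1[ -> flex (X r) [tuple Xi r]),
        (forall p : M, is_derive (0 : R) 1 (fun r => X r p) (2 *: Xi 0 p)) &
        Xi 0 = xi].

End SurfacesInSpace.

(* Main.v *)
Require Import Defs.
From mathcomp Require Import all_boot all_order all_algebra.
From mathcomp Require Import all_classical all_reals all_analysis.
From mathcomp Require Import ring lra.
Import Order.TTheory GRing.Theory Num.Theory.
Import numFieldNormedType.Exports.

(* The second-order field is xi2 = (1/2) d/dr Xi(r) at r = 0.  Differentiating the
   flex equation dX(r) dXi(r) = 0 of the nearby surfaces at r = 0, where
   dX/dr = 2 xi1, gives 2 dxi1 dxi1 + 2 dx dxi2 = 0; this uses that d/dr commutes
   with the derivatives along the surface.  Since flexes are defined by lengths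
   of curves, two translations are needed.  If dx dxi is nonzero in some
   direction, the length of a short straight segment in a chart in that
   direction grows at least linearly in |t| on one side of t = 0.  Conversely,
   when the second-order equations hold, the squared speed of a curve changes by
   O(t^3) times itself, because x is an immersion, and so does its length. *)

Set Implicit Arguments.
Unset Strict Implicit.
Unset Printing Implicit Defensive.

Local Open Scope classical_set_scope.
Local Open Scope ring_scope.

(** * Smooth maps *)

Section Calculus.
Variable R : realType.
Implicit Types E F G : normedModType R.

(** The differential of [f] serves for [g] as well, since the little-o expansion at [p] depends only
    on the germ. *)
Lemma near_eq_differentiable E F (f g : E -> F) p :
  (\near p, f p = g p) -> differentiable f p -> differentiable g p.
Proof.
move=> fg /diff_locallyP[cdf dfE].
have gE : g \o shift p = cst (g p) + 'd f p +o_ 0 id.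
  apply/eqaddoP => e e0; move/eqaddoP : dfE => /(_ e e0).
  have fg0 : \forall h \near (0 : E), f (h + p) = g (h + p).
    move: (fg); rewrite (near_shift 0) subr0; apply: filterS => h.
    exact.
  move=> dfn; apply: filterS2 fg0 dfn => h /= fgh; rewrite /= !fctE /= fgh.
  by rewrite (nbhs_singleton fg).
by apply/diff_locallyP; rewrite (diff_unique cdf gE).
Qed.

Lemma derive_comp E F G (g : E -> F) (f : F -> G) p v :
  differentiable g p -> differentiable f (g p) ->
  'D_v (f \o g) p = 'D_('D_v g p) f (g p).
Proof.
move=> dg df; have dfg := differentiable_comp dg df.
by rewrite !deriveE// diff_comp.
Qed.

Lemma derive_addv E F (f : E -> F) p v w (a b : R) : differentiable f p ->
  'D_(a *: v + b *: w) f p = a *: 'D_v f p + b *: 'D_w f p.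
Proof. by move=> df; rewrite !deriveE// linearD !linearZ. Qed.

Lemma sub_Ck E F k (U V : set E) (f : E -> F) :
  V `<=` U -> Ck k U f -> Ck k V f.
Proof.
elim: k f => [|k IH] f VU; first by move=> Uf p /VU/Uf.
by case=> df Df; split=> [p Vp|v]; [exact/df/VU | exact: IH (Df v)].
Qed.

(** Openness turns equality on [U] into equality of germs, which passes to every directional
    derivative; this drives the induction on [k]. *)
Lemma eq_Ck E F k (U : set E) (f g : E -> F) :
  open U -> {in U, f =1 g} -> Ck k U f -> Ck k U g.
Proof.
move=> oU; elim: k f g => [|k IH] f g fg.
  move=> cf p Up; have cfp : f @ p --> f p by exact: cf.
  suff : g @ p --> g p by [].
  rewrite -(fg p (mem_set Up)); apply: cvg_trans cfp; apply: near_eq_cvg.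
  by have := open_nbhs_nbhs (conj oU Up); apply: filterS => q Uq; rewrite fg ?inE.
have nfg p : U p -> \near p, f p = g p.
  move=> Up; have := open_nbhs_nbhs (conj oU Up).
  by apply: filterS => q Uq; rewrite fg ?inE.
case=> df Df; split=> [p Up|v].
  exact: near_eq_differentiable (nfg _ Up) (df p Up).
apply: IH (Df v) => p; rewrite inE => Up.
exact/near_eq_derive/nfg.
Qed.

(** The differential [dg] is the same at every point, so the derivative of [f \o g] along [v] is the
    derivative of [f] along the fixed vector [dg v], composed with [g]. It has the same shape again,
    and the induction closes without a product rule. *)
Lemma Ck_comp_affine E F G k (U : set F) (f : F -> G) (g dg : E -> F) :
  open U -> (forall p, is_diff p g dg) -> Ck k U f -> Ck k (g @^-1` U) (f \o g).
Proof.
move=> oU gdg.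
have cg : continuous g by move=> p; exact/differentiable_continuous/ex_diff.
elim: k f => [|k IH] f.
  by move=> cf p Up; apply: continuous_comp; [exact: cg | exact: cf].
case=> df Df; split=> [p Up|v].
  by apply: differentiable_comp; [exact: ex_diff | exact: df].
apply: eq_Ck (IH _ (Df (dg v))); first exact: open_comp.
move=> p; rewrite inE => Up /=.
have gv : 'D_v g p = dg v by rewrite deriveE ?diff_val.
by rewrite derive_comp ?gv//; exact: df.
Qed.

End Calculus.

(** * Symmetry of second derivatives *)

Section Schwarz.
Variables (R : realType) (E : normedModType R).

Lemma derivable_line_is_derive (f : E -> R) p v s df :
  is_derive (p + s *: v) v f df -> is_derive s (1 : R) (fun r : R => f (p + r *: v)) df.
Proof.
move=> [dfs <-]; rewrite /derivable /derive in dfs *.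
have eqq : (fun h : R => h^-1 *: (f (h *: v + (p + s *: v)) - f (p + s *: v)))
  = (fun h : R => h^-1 *: (f (p + (h *: (1 : R) + s) *: v) - f (p + s *: v))).
  by apply/funext => h; rewrite scalerDl [h *: 1]mulr1 addrCA.
by split; rewrite /derivable /derive /= -eqq.
Qed.

Lemma is_derive_translate (f : E -> R) p w c df :
  is_derive (p + c) w f df -> is_derive p w (fun q => f (q + c)) df.
Proof.
move=> [dfs <-]; rewrite /derivable /derive /= in dfs *.
have eqq : (fun h : R => h^-1 *: (f (h *: w + (p + c)) - f (p + c)))
  = (fun h : R => h^-1 *: (f (h *: w + p + c) - f (p + c))).
  by apply/funext => h; rewrite addrA.
by split; rewrite /derivable /derive /= -eqq.
Qed.

Lemma MVT_line (f df : E -> R) p v h : 0 < h ->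
  (forall s, 0 <= s <= h -> is_derive (p + s *: v) v f (df (p + s *: v))) ->
  exists2 s, 0 <= s <= h & f (p + h *: v) - f p = h * df (p + s *: v).
Proof.
move=> h0 fdf.
have dl s : 0 <= s <= h ->
    is_derive s (1 : R) (fun r : R => f (p + r *: v)) (df (p + s *: v)).
  by move=> /fdf/derivable_line_is_derive.
have [||c c0h] := @MVT R (fun r : R => f (p + r *: v))
    (fun r => df (p + r *: v)) 0 h h0.
- by move=> x; rewrite in_itv/= => /andP[x0 xh]; apply: dl; rewrite !ltW.
- apply: derivable_within_continuous => x; rewrite in_itv/= => xh.
  exact: (@ex_derive _ _ _ _ _ _ _ (dl x xh)).
- rewrite scale0r addr0 subr0 mulrC => ->; exists c => //.
  by move: c0h; rewrite in_itv/= => /andP[x0 xh]; rewrite !ltW.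
Qed.

(* Mean value theorem applied first along [w], then along [v]. *)
Lemma second_difference (f fw fwv : E -> R) p v w h : 0 < h ->
  (forall a s, 0 <= a <= h -> 0 <= s <= h ->
     is_derive (p + a *: v + s *: w) w f (fw (p + a *: v + s *: w)) /\
     is_derive (p + a *: v + s *: w) v fw (fwv (p + a *: v + s *: w))) ->
  exists a s, [/\ 0 <= a <= h, 0 <= s <= h &
    f (p + h *: v + h *: w) - f (p + h *: v) - f (p + h *: w) + f p =
    h * (h * fwv (p + a *: v + s *: w))].
Proof.
move=> h0 fd.
have hh : 0 <= h <= h by rewrite lexx ltW.
have oh : (0 : R) <= 0 <= h by rewrite lexx ltW.
(* The second difference is the increment along [h *: w] of the increment of [f] along [h *: v]. *)
have [|s sh fs] := @MVT_line (fun q => f (q + h *: v) - f q)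
    (fun q => fw (q + h *: v) - fw q) p w h h0.
  move=> s sh.
  have [] := fd h s hh sh; rewrite addrAC => fdh _.
  have [] := fd 0 s oh sh; rewrite scale0r addr0 => fd0 _.
  apply: is_deriveB.
  exact: is_derive_translate fdh.
have [|a ah fa] := @MVT_line fw fwv (p + s *: w) v h h0.
  by move=> a ah; have [_] := fd a s ah sh; rewrite addrAC.
exists a, s; split => //; rewrite [p + a *: v + _]addrAC -fa -fs.
rewrite [p + h *: w + h *: v]addrAC; ring.
Qed.

(** The second difference of [f] over the parallelogram spanned by [h *: v] and [h *: w] is
    symmetric in [v] and [w]. Each order of differentiation writes it as [h * h] times a mixed
    derivative at some point of the parallelogram, and continuity at [p] makes both values close to
    those at [p]. *)
Lemma mixed_derivative_eq (f fv fw fwv fvw : E -> R) p v w :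
  (\forall q \near p, is_derive q v f (fv q) /\ is_derive q w f (fw q)) ->
  (\forall q \near p, is_derive q v fw (fwv q) /\ is_derive q w fv (fvw q)) ->
  {for p, continuous fwv} -> {for p, continuous fvw} ->
  fwv p = fvw p.
Proof.
move=> df ddf cvw cwv.
apply/eqP; rewrite -subr_eq0 -normr_le0; apply/ler_addgt0Pr => e e0; rewrite add0r.
have e2 : 0 < e / 2 by rewrite divr_gt0.
have nvw : \forall q \near p, `|fwv q - fwv p| <= e / 2.
  by move/cvgrPdistC_le : cvw; apply.
have nwv : \forall q \near p, `|fvw q - fvw p| <= e / 2.
  by move/cvgrPdistC_le : cwv; apply.
have [r /= r0 Hr] := (nbhs_ballP _ _).1 (filterI (filterI df ddf) (filterI nvw nwv)).
pose N := `|v| + `|w| + 1.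
have N0 : 0 < N by rewrite /N ltr_wpDl// addr_ge0.
(* With this choice [h * N] is [r / 2], so the whole parallelogram stays in the ball of radius
   [r]. *)
pose h := r / (2 * N).
have h0 : 0 < h by rewrite /h divr_gt0// mulr_gt0.
have Hq a s : 0 <= a <= h -> 0 <= s <= h -> ball p r (p + a *: v + s *: w).
  move=> /andP[a0 ah] /andP[s0 sh].
  rewrite -ball_normE/= -addrA opprD addNKr normrN.
  rewrite (le_lt_trans (ler_normD _ _))// !normrZ !ger0_norm//.
  apply: (@le_lt_trans _ _ (h * N)).
    rewrite /N !mulrDr mulr1 -[X in X <= _]addr0 lerD ?(ltW h0)//.
    by rewrite lerD// ler_wpM2r.
  by rewrite /h invfM mulrA mulfVK ?gt_eqF// gtr_pMr// invf_lt1// ltr1n.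
have [|a [s [ah sh]]] := @second_difference f fw fwv p v w h h0.
  by move=> a s ah sh; have [[[_ ?] [? _]] _] := Hr _ (Hq a s ah sh).
have [|a' [s' [ah' sh']]] := @second_difference f fv fvw p w v h h0.
  move=> a' s' ah' sh'; rewrite addrAC.
  by have [[[? _] [_ ?]] _] := Hr _ (Hq s' a' sh' ah').
rewrite [p + h *: w + h *: v]addrAC [X in X + _ = _]addrAC => ->.
move=> /(mulfI (lt0r_neq0 h0))/(mulfI (lt0r_neq0 h0)) eqvw.
have [_ [l1 _]] := Hr _ (Hq _ _ ah sh).
have [_ [_]] := Hr _ (Hq _ _ sh' ah').
rewrite [p + s' *: v + _]addrAC eqvw => l2.
rewrite [e]splitr; apply: le_trans (lerD l1 l2).
by rewrite [X in _ <= X + _]distrC ler_distD.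
Qed.

End Schwarz.

(** * The Euclidean scalar product *)

Section Dot.
Variable R : realType.
Local Notation E3 := 'rV[R]_3.
Implicit Types a b c : E3.

Definition dot a b : R := \sum_i a 0 i * b 0 i.

Lemma enormE a : enorm a = Num.sqrt (dot a a).
Proof. by []. Qed.

Lemma dotC a b : dot a b = dot b a.
Proof. by apply: eq_bigr => i _; rewrite mulrC. Qed.

Lemma dotDl a b c : dot (a + b) c = dot a c + dot b c.
Proof. by rewrite -big_split; apply: eq_bigr => i _; rewrite mxE mulrDl. Qed.

Lemma dotZl k a b : dot (k *: a) b = k * dot a b.
Proof. by rewrite mulr_sumr; apply: eq_bigr => i _; rewrite mxE mulrA. Qed.

Lemma dotDr a b c : dot a (b + c) = dot a b + dot a c.
Proof. by rewrite !(dotC a) dotDl. Qed.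

Lemma dotZr k a b : dot a (k *: b) = k * dot a b.
Proof. by rewrite !(dotC a) dotZl. Qed.

Lemma dot_ge0 a : 0 <= dot a a.
Proof. by apply: sumr_ge0 => i _; rewrite -expr2 sqr_ge0. Qed.

Lemma dot_eq0 a : dot a a = 0 -> a = 0.
Proof.
move=> /psumr_eq0P a0; apply/rowP => i; rewrite mxE.
have : a 0 i * a 0 i = 0 by apply: a0 => // j _; rewrite -expr2 sqr_ge0.
by move/eqP; rewrite mulf_eq0 orbb => /eqP.
Qed.

Lemma dot_AMGM a b : `|dot a b| <= (dot a a + dot b b) / 2.
Proof.
have := dot_ge0 (a + b); have := dot_ge0 (a + (-1) *: b).
rewrite !(dotDl, dotDr, dotZl, dotZr) (dotC b a) => h1 h2.
by rewrite ler_norml; apply/andP; split; lra.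
Qed.

(** Factor [y - x] as a difference of squares of roots and divide by a sum of roots that is at least
    the root of [x]. If [x] is 0, the bound forces [y] to be 0; this covers the points where a curve
    has zero velocity. *)
Lemma sqrt_defect_le (x y m : R) : 0 <= x -> 0 <= y -> `|y - x| <= m * x ->
  `|Num.sqrt y - Num.sqrt x| <= m * Num.sqrt x.
Proof.
rewrite le_eqVlt => /predU1P[<- y0|x0 y0].
  rewrite mulr0 subr0 normr_le0 => /eqP ->.
  by rewrite subrr sqrtr0 normr0 mulr0.
have s0 : 0 < Num.sqrt x by rewrite sqrtr_gt0.
rewrite -{1}(sqr_sqrtr y0) -{1 2}(sqr_sqrtr (ltW x0)) subr_sqr normrM.
rewrite [X in _ * X]ger0_norm ?addr_ge0 ?sqrtr_ge0// => h.
rewrite -(ler_pM2r s0) -mulrA -expr2; apply: le_trans h.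
by rewrite ler_wpM2l// lerDr sqrtr_ge0.
Qed.

(** The difference of the roots is [y - x] divided by the sum of the roots, and that sum is at most
    twice the root of [L]. *)
Lemma sqrt_growth_ge (x y d L : R) : 0 <= x -> 0 <= d -> x + d <= y -> y <= L ->
  0 < L -> d / (2 * Num.sqrt L) <= Num.sqrt y - Num.sqrt x.
Proof.
move=> x0 d0 xdy yL L0.
have sL : 0 < Num.sqrt L by rewrite sqrtr_gt0.
have y0 : 0 <= y by lra.
have xy : Num.sqrt x <= Num.sqrt y by rewrite ler_wsqrtr//; lra.
have yl : Num.sqrt y <= Num.sqrt L by rewrite ler_wsqrtr.
have s1 := sqr_sqrtr x0; have s2 := sqr_sqrtr y0.
rewrite ler_pdivrMr ?mulr_gt0//.
apply: (@le_trans _ _ ((Num.sqrt y - Num.sqrt x) * (Num.sqrt y + Num.sqrt x))).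
  by rewrite -subr_sqr s1 s2; lra.
by rewrite ler_wpM2l ?subr_ge0//; lra.
Qed.

(** In the squared speed the coefficients of [t] and [t ^+ 2] are 4 times the two vanishing
    expressions. What remains is a cubic term with factor 8 and a quartic one with factor 4, whence
    the constant 12. *)
Lemma second_order_speed a b c (K t : R) :
  dot a b = 0 -> dot b b + dot a c = 0 ->
  dot b b <= K * dot a a -> dot c c <= K * dot a a -> `|t| <= 1 ->
  `|enorm (a + ((2 * t) *: b + (2 * t ^+ 2) *: c)) - enorm a|
    <= 12 * K * `|t| ^+ 3 * enorm a.
Proof.
move=> ab bbac bK cK t1; rewrite !enormE.
apply: sqrt_defect_le; [exact: dot_ge0|exact: dot_ge0|].
have -> : dot (a + ((2 * t) *: b + (2 * t ^+ 2) *: c))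
              (a + ((2 * t) *: b + (2 * t ^+ 2) *: c)) - dot a a =
          8 * t ^+ 3 * dot b c + 4 * t ^+ 4 * dot c c.
  rewrite !(dotDl, dotDr, dotZl, dotZr) (dotC b a) (dotC c a) (dotC c b) ab.
  have -> : dot a c = - dot b b by lra.
  ring.
have bc : `|dot b c| <= K * dot a a by apply: le_trans (dot_AMGM b c) _; lra.
have k0 : 0 <= K * dot a a by apply: le_trans bK; exact: dot_ge0.
have cc : `|dot c c| <= K * dot a a by rewrite ger0_norm// dot_ge0.
apply: le_trans (ler_normD _ _) _.
have nX (k : R) n d : 0 <= k -> `|k * t ^+ n * d| = k * (`|t| ^+ n * `|d|).
  by move=> k0'; rewrite -mulrA normrM normrM normrX (ger0_norm k0').
rewrite !nX//.
have t3 : 0 <= `|t| ^+ 3 by rewrite exprn_ge0.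
have t4 : `|t| ^+ 4 <= `|t| ^+ 3 by rewrite [X in X <= _]exprSr ler_piMr.
have h1 : `|t| ^+ 3 * `|dot b c| <= `|t| ^+ 3 * (K * dot a a) by rewrite ler_wpM2l.
have h2 : `|t| ^+ 4 * `|dot c c| <= `|t| ^+ 3 * (K * dot a a).
  by apply: ler_pM => //; rewrite exprn_ge0.
have -> : 12 * K * `|t| ^+ 3 * dot a a =
  8 * (`|t| ^+ 3 * (K * dot a a)) + 4 * (`|t| ^+ 3 * (K * dot a a)) by ring.
by rewrite lerD// ler_wpM2l.
Qed.

(** The sign of [t] is matched to that of [dot a b], so the linear term of the squared speed is at
    least [4 * |t| * q], while [L] bounds the squared speed for [|t| <= 1]. *)
Lemma first_order_speed a b (q L t : R) :
  0 <= q -> q <= Num.sg t * dot a b ->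
  dot a a + 4 * `|dot a b| + 4 * dot b b <= L -> 0 < L -> `|t| <= 1 ->
  `|t| * (2 * q / Num.sqrt L) <= enorm (a + (2 * t) *: b) - enorm a.
Proof.
move=> q0 qab abL L0 t1; rewrite !enormE.
have e : dot (a + (2 * t) *: b) (a + (2 * t) *: b) =
         dot a a + 4 * t * dot a b + 4 * `|t| ^+ 2 * dot b b.
  by rewrite !(dotDl, dotDr, dotZl, dotZr) (dotC b a) real_normK ?num_real//; ring.
have -> : `|t| * (2 * q / Num.sqrt L) = (4 * (`|t| * q)) / (2 * Num.sqrt L).
  by field; rewrite gt_eqF// sqrtr_gt0.
have tt : 4 * (`|t| * q) <= 4 * t * dot a b.
  rewrite -mulrA ler_wpM2l// {2}[t]numEsg -mulrA mulrCA.
  by rewrite ler_wpM2l.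
have b0 := dot_ge0 b.
have t20 : 0 <= `|t| ^+ 2 * dot b b by rewrite mulr_ge0// exprn_ge0.
apply: sqrt_growth_ge => //; first exact: dot_ge0.
- by rewrite !mulr_ge0.
- by rewrite e -[4 * `|t| ^+ 2 * _]mulrA; lra.
- apply: le_trans abL; rewrite e -[4 * t * _]mulrA -[4 * `|t| ^+ 2 * _]mulrA.
  apply: lerD; [apply: lerD => //|].
    apply: ler_wpM2l => //; apply: le_trans (ler_norm _) _.
    by rewrite normrM; apply: ler_piMl.
  by apply: ler_wpM2l => //; apply: ler_piMl => //; rewrite exprn_ile1.
Qed.

Lemma cvg_dot (T : Type) (F : set_system T) (FF : Filter F) (f g : T -> E3) a b :
  f @ F --> a -> g @ F --> b -> (fun x => dot (f x) (g x)) @ F --> dot a b.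
Proof.
move=> fa gb.
have fgi (i : 'I_3) : (fun x => f x 0 i * g x 0 i) @ F --> a 0 i * b 0 i.
  apply: cvgM.
    exact: (cvg_comp _ _ fa (@coord_continuous _ _ _ 0 i a)).
  exact: (cvg_comp _ _ gb (@coord_continuous _ _ _ 0 i b)).
rewrite /dot; under eq_fun do rewrite !big_ord_recl big_ord0 addr0.
by rewrite !big_ord_recl big_ord0 addr0; apply: cvgD => //; apply: cvgD.
Qed.

Lemma cvg_enorm (T : Type) (F : set_system T) (FF : Filter F) (f : T -> E3) a :
  f @ F --> a -> (fun x => enorm (f x)) @ F --> enorm a.
Proof.
move=> fa; rewrite enormE.
exact: (cvg_comp _ _ (cvg_dot FF fa fa) (@sqrt_continuous _ _)).
Qed.

Lemma is_derive_coord (E : normedModType R) m n (f : E -> 'M[R]_(m, n)) p v df i j :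
  is_derive p v f df -> is_derive p v (fun q => f q i j) (df i j).
Proof.
move=> [dfp <-]; split; first exact: ((derivable_mxP _ _ _).1 dfp i j).
by rewrite derive_mx// mxE.
Qed.

Lemma is_derive_dot (E : normedModType R) (f g : E -> E3) p v df dg :
  is_derive p v f df -> is_derive p v g dg ->
  is_derive p v (fun q => dot (f q) (g q)) (dot df (g p) + dot (f p) dg).
Proof.
move=> fdf gdg.
have -> : (fun q => dot (f q) (g q)) =
  \sum_(i < 3) ((fun q => f q 0 i) * (fun q => g q 0 i)).
  by apply/funext => q; rewrite fct_sumE.
rewrite /dot -big_split; apply: is_derive_sum => i /=.
have fi := is_derive_coord 0 i fdf; have gi := is_derive_coord 0 i gdg.
by apply: is_derive_eq; rewrite addrC /GRing.scale/= [g p 0 i * _]mulrC.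
Qed.

End Dot.

(** * Lengths of perturbed curves *)

Section Lengths.
Variable R : realType.
Local Notation E3 := 'rV[R]_3.
Local Notation mu := (@lebesgue_measure R).

Lemma integrable_continuous_itv (a b : R) (f : R -> R) :
  (forall s, a <= s <= b -> {for s, continuous f}) ->
  mu.-integrable `[a, b] (EFin \o f).
Proof.
move=> cf; apply: continuous_compact_integrable; first exact: segment_compact.
by apply: continuous_in_subspaceT => s; rewrite inE/= in_itv/= => /cf.
Qed.

Lemma continuous_enorm (f : R -> E3) s :
  {for s, continuous f} -> {for s, continuous (fun s => enorm (f s))}.
Proof. by move=> cf; apply: cvg_enorm. Qed.

Lemma length_perturbation_le (a b m : R) (f g : R -> E3) :
  (forall s, a <= s <= b -> {for s, continuous f}) ->
  (forall s, a <= s <= b -> {for s, continuous g}) ->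
  (forall s, a <= s <= b -> `|enorm (g s) - enorm (f s)| <= m * enorm (f s)) ->
  `|\int[mu]_(s in `[a, b]) enorm (g s) - \int[mu]_(s in `[a, b]) enorm (f s)|
  <= m * \int[mu]_(s in `[a, b]) enorm (f s).
Proof.
move=> cf cg fg.
have cef s : a <= s <= b -> {for s, continuous (fun s => enorm (f s))}.
  by move=> sab; exact/continuous_enorm/cf.
have ceg s : a <= s <= b -> {for s, continuous (fun s => enorm (g s))}.
  by move=> sab; exact/continuous_enorm/cg.
have iff := integrable_continuous_itv cef.
have ig := integrable_continuous_itv ceg.
have cgf s : a <= s <= b -> {for s, continuous (fun s => enorm (g s) - enorm (f s))}.
  by move=> sab; apply: cvgB; [exact: ceg|exact: cef].
rewrite -RintegralB//.
apply: le_trans (le_normr_Rintegral _ (integrable_continuous_itv cgf)) _ => //.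
rewrite -RintegralZl//; apply: le_Rintegral => //.
- apply: integrable_continuous_itv => s sab.
  exact: (cvg_norm (cgf s sab)).
- apply: integrable_continuous_itv => s sab.
  by apply: cvgM; [exact: cvg_cst|exact: cef].
Qed.

Lemma length_growth_ge (a b k : R) (f g : R -> E3) : a <= b ->
  (forall s, a <= s <= b -> {for s, continuous f}) ->
  (forall s, a <= s <= b -> {for s, continuous g}) ->
  (forall s, a <= s <= b -> k <= enorm (g s) - enorm (f s)) ->
  k * (b - a) <=
  \int[mu]_(s in `[a, b]) enorm (g s) - \int[mu]_(s in `[a, b]) enorm (f s).
Proof.
move=> ab cf cg fg.
have cef s : a <= s <= b -> {for s, continuous (fun s => enorm (f s))}.
  by move=> sab; exact/continuous_enorm/cf.
have ceg s : a <= s <= b -> {for s, continuous (fun s => enorm (g s))}.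
  by move=> sab; exact/continuous_enorm/cg.
have iff := integrable_continuous_itv cef.
have ig := integrable_continuous_itv ceg.
have cgf s : a <= s <= b -> {for s, continuous (fun s => enorm (g s) - enorm (f s))}.
  by move=> sab; apply: cvgB; [exact: ceg|exact: cef].
have <- : \int[mu]_(_ in `[a, b]) k = k * (b - a).
  rewrite Rintegral_cst//= lebesgue_measure_itv/= lte_fin.
  by case: ltgtP ab => [ab|//|->] _; rewrite ?subrr ?mulr0.
rewrite -RintegralB//; apply: le_Rintegral => //.
- by apply: integrable_continuous_itv => s _; exact: cvg_cst.
- exact: (integrable_continuous_itv cgf).
Qed.

Lemma second_order_length (a b K : R) (f g h : R -> E3) :
  (forall s, a <= s <= b -> [/\ {for s, continuous f}, {for s, continuous g} &
     {for s, continuous h}]) ->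
  (forall s, a <= s <= b -> dot (f s) (g s) = 0 /\
     dot (g s) (g s) + dot (f s) (h s) = 0) ->
  (forall s, a <= s <= b -> dot (g s) (g s) <= K * dot (f s) (f s) /\
     dot (h s) (h s) <= K * dot (f s) (f s)) ->
  (fun t : R => \int[mu]_(s in `[a, b])
       enorm (f s + ((2 * t) *: g s + (2 * t ^+ 2) *: h s))
     - \int[mu]_(s in `[a, b]) enorm (f s)) =o_ (0 : R) (fun t => t ^+ 2).
Proof.
move=> cfgh fgh fghK; apply/eqoP => e e0.
set I := \int[mu]_(s in `[a, b]) enorm (f s).
have t0 : \forall t \near (0 : R), `|t| <= 1 /\ `|t| * `|12 * K * I| <= e.
  have t1 : \forall t \near (0 : R), `|t| <= 1.
    apply: filterS (nbhs0_lt ltr01) => t; exact: ltW.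
  (* Adding 1 keeps the denominator positive when the product vanishes; the absolute value avoids a
     sign assumption on [K]. *)
  have d0 : 0 < e / (`|12 * K * I| + 1) by rewrite divr_gt0// ltr_wpDl.
  have t2 : \forall t \near (0 : R), `|t| < e / (`|12 * K * I| + 1).
    exact: nbhs0_lt d0.
  apply: filterS2 t1 t2 => t t1; rewrite ltr_pdivlMr ?ltr_wpDl// => te.
  split=> //; apply: le_trans (ltW te).
  by rewrite ler_wpM2l// lerDl.
apply: filterS t0 => t [t1 te].
have cont s : a <= s <= b ->
  {for s, continuous (fun s => f s + ((2 * t) *: g s + (2 * t ^+ 2) *: h s))}.
  move=> /cfgh[cf cg ch]; apply: cvgD => //.
  by apply: cvgD; apply: cvgZ => //; exact: cvg_cst.
apply: (@le_trans _ _ (12 * K * `|t| ^+ 3 * I)).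
  apply: length_perturbation_le => // s sab; first by case: (cfgh s sab).
  have [? ?] := fgh s sab; have [? ?] := fghK s sab.
  exact: second_order_speed.
have -> : 12 * K * `|t| ^+ 3 * I = `|t| ^+ 2 * (`|t| * (12 * K * I)) by ring.
rewrite normrX mulrC ler_wpM2r ?exprn_ge0//.
by apply: le_trans te; rewrite ler_wpM2l// ler_norm.
Qed.

(** If the product at 0 were nonzero, continuity would give [first_order_speed] with uniform
    constants on a short interval, and the length would change at linear rate. The hypothesis covers
    every [e <= d] because the interval is chosen only after this continuity argument. *)
Lemma first_order_length (d : R) (f g : R -> E3) : 0 < d ->
  (forall s, 0 <= s <= d -> {for s, continuous f} /\ {for s, continuous g}) ->
  (forall e, 0 < e <= d ->
    (fun t : R => \int[mu]_(s in `[0, e]) enorm (f s + (2 * t) *: g s)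
       - \int[mu]_(s in `[0, e]) enorm (f s)) =o_ (0 : R) (fun t => t ^+ 1)) ->
  dot (f 0) (g 0) = 0.
Proof.
move=> d0 cfg fgo; apply/eqP/negPn/negP => q0.
have [cf0 cg0] : {for 0, continuous f} /\ {for 0, continuous g}.
  by apply: cfg; rewrite lexx ltW.
set q := `|dot (f 0) (g 0)|.
have qp : 0 < q by rewrite normr_gt0.
set sg := Num.sg (dot (f 0) (g 0)).
(* The added 1 lets the bound on the squared speed at 0 persist nearby. *)
set L := dot (f 0) (f 0) + 4 * `|dot (f 0) (g 0)| + 4 * dot (g 0) (g 0) + 1.
have L0 : 0 < L.
  by rewrite ltr_wpDl// !addr_ge0 ?dot_ge0// mulr_ge0// dot_ge0.
have cq : (fun s => sg * dot (f s) (g s)) @ (0 : R) --> q.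
  have -> : q = sg * dot (f 0) (g 0) by rewrite /q /sg normrEsg.
  by apply: cvgM; [exact: cvg_cst|exact: cvg_dot].
have cL : (fun s => dot (f s) (f s) + 4 * `|dot (f s) (g s)| + 4 * dot (g s) (g s))
    @ (0 : R) --> L - 1.
  rewrite /L addrK; apply: cvgD; [apply: cvgD|]; first exact: cvg_dot.
    by apply: cvgM; [exact: cvg_cst|apply: cvg_norm; exact: cvg_dot].
  by apply: cvgM; [exact: cvg_cst|exact: cvg_dot].
have n1 : \forall s \near (0 : R), q / 2 < sg * dot (f s) (g s).
  by apply: (cvgr_gt _ cq); rewrite ltr_pdivrMr// ltr_pMr// ltr1n.
have n2 : \forall s \near (0 : R),
    dot (f s) (f s) + 4 * `|dot (f s) (g s)| + 4 * dot (g s) (g s) < L.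
  by apply: (cvgr_lt _ cL); rewrite ltrBlDr ltrDl.
have [r /= r0 Hr] := (nbhs_ballP _ _).1 (filterI n1 n2).
pose e := Num.min d (r / 2).
have e0 : 0 < e by rewrite lt_min d0 divr_gt0.
have ed : e <= d by rewrite ge_min lexx.
have er : e < r.
  by rewrite gt_min; apply/orP; right; rewrite ltr_pdivrMr// ltr_pMr// ltr1n.
(* This is the slope in [first_order_speed], with [q / 2] as the lower bound valid near 0. The
   little-o is then tested against half of the resulting growth [k * e]. *)
pose k := 2 * (q / 2) / Num.sqrt L.
have k0 : 0 < k by rewrite divr_gt0 ?sqrtr_gt0// mulr_gt0// divr_gt0.
have ke2 : 0 < k * e / 2 by rewrite divr_gt0// mulr_gt0.
have /eqoP /(_ _ ke2) fgk := fgo e (introT andP (conj e0 ed)).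
have [rho /= rho0 Hrho] := (nbhs_ballP _ _).1 fgk.
(* [t = sg * tau] makes the first-order term of the squared speed positive. *)
pose tau := Num.min 1 (rho / 2).
have tau0 : 0 < tau by rewrite lt_min ltr01 divr_gt0.
have tau1 : tau <= 1 by rewrite ge_min lexx.
have taur : tau < rho.
  by rewrite gt_min; apply/orP; right; rewrite ltr_pdivrMr// ltr_pMr// ltr1n.
have nsg : `|sg| = 1 by rewrite normr_sg q0.
have nt : `|sg * tau| = tau by rewrite normrM nsg mul1r gtr0_norm.
have := Hrho (sg * tau); rewrite -ball_normE/= sub0r normrN nt => /(_ taur).
rewrite /= ?expr1 ?nt => up.
have low : tau * k * (e - 0) <=
  \int[mu]_(s in `[0, e]) enorm (f s + (2 * (sg * tau)) *: g s)
    - \int[mu]_(s in `[0, e]) enorm (f s).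
  have sd s : 0 <= s <= e -> 0 <= s <= d.
    by case/andP=> -> /= /le_trans; apply.
  apply: length_growth_ge; first exact: ltW.
  - by move=> s /sd/cfg[].
  - move=> s /sd/cfg[cf cg]; by apply: cvgD => //; apply: cvgZ => //; exact: cvg_cst.
  - move=> s se; have [] := Hr s.
      rewrite -ball_normE/= sub0r normrN ger0_norm; case/andP: se => // s0 se.
      exact: le_lt_trans er.
    move=> /ltW h1 /ltW h2; rewrite -{1}nt.
    apply: first_order_speed h2 _ _ => //.
    - by rewrite divr_ge0// ltW.
    - rewrite sgrM (gtr0_sg tau0) mulr1.
      by rewrite /sg sgr_id.
    - by rewrite nt.
have := le_trans low (le_trans (ler_norm _) up).
rewrite subr0 (_ : k * e / 2 * tau = tau * k * e / 2); last by ring.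
have : 0 < tau * k * e by apply: mulr_gt0 => //; exact: mulr_gt0.
lra.
Qed.

End Lengths.

(** * Curves on surfaces *)

Section Smooth.
Variables (R : realType) (E F : normedModType R) (U : set E) (f : E -> F).

Lemma smooth_differentiable p : smooth_on U f -> U p -> differentiable f p.
Proof. by move=> /(_ 1%N)[+ _]; apply. Qed.

Lemma smooth_derive v : smooth_on U f -> smooth_on U ('D_v f).
Proof. by move=> sf k; have [_] := sf k.+1; apply. Qed.

Lemma smooth_continuous p : smooth_on U f -> U p -> {for p, continuous f}.
Proof. by move=> /(_ 0%N); apply. Qed.

End Smooth.

Lemma open_setI_preimage (S T : topologicalType) (A : set S) (B : set T) (f : S -> T) :
  open A -> open B -> (forall p, A p -> {for p, continuous f}) ->
  open (A `&` f @^-1` B).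
Proof.
move=> oA oB cf; rewrite openE => p [Ap Bfp]; apply: filterI.
  exact: open_nbhs_nbhs.
exact: (cf p Ap _ (open_nbhs_nbhs (conj oB Bfp))).
Qed.

Lemma near_eq_continuous (S T : topologicalType) (f g : S -> T) p :
  (\forall q \near p, f q = g q) -> {for p, continuous f} -> {for p, continuous g}.
Proof.
move=> fg cf; suff : g @ p --> g p by [].
rewrite -(nbhs_singleton fg); apply: cvg_trans (cf : f @ p --> f p).
exact: near_eq_cvg.
Qed.

(** * Immersions of plane domains *)

Section Plane.
Variable R : realType.
Local Notation E2 := 'rV[R]_2.
Local Notation E3 := 'rV[R]_3.
Implicit Types (U : set E2) (x xi : E2 -> E3) (u v : E2).

Lemma plane_basis v : v = v 0 0 *: delta_mx 0 0 + v 0 1 *: delta_mx 0 1.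
Proof.
apply/rowP => -[[|[|//]] i2]; rewrite !mxE/= ?mulr1 ?mulr0 ?addr0 ?add0r;
  by congr (v 0 _); apply/val_inj.
Qed.

Lemma derive_plane x u v : differentiable x u ->
  'D_v x u = v 0 0 *: 'D_(delta_mx 0 0) x u + v 0 1 *: 'D_(delta_mx 0 1) x u.
Proof. by move=> dx; rewrite {1}[v]plane_basis derive_addv. Qed.

(** Both the base point and the direction vary. Expanding the direction in the standard basis leaves
    two derivatives in fixed directions, whose continuity is part of smoothness. *)
Lemma continuous_derive_along U x (T : topologicalType) (u v : T -> E2) s :
  open U -> smooth_on U x -> U (u s) ->
  {for s, continuous u} -> {for s, continuous v} ->
  {for s, continuous (fun s => 'D_(v s) x (u s))}.
Proof.
move=> oU sx Us cu cv.
have nU : \forall s' \near s, U (u s').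
  exact: (cu _ (open_nbhs_nbhs (conj oU Us))).
apply: (@near_eq_continuous _ _ (fun s => v s 0 0 *: 'D_(delta_mx 0 0) x (u s)
    + v s 0 1 *: 'D_(delta_mx 0 1) x (u s))).
  apply: filterS nU => s' Us'.
  by rewrite -derive_plane//; exact: smooth_differentiable sx Us'.
have cD w : {for s, continuous (fun s => 'D_w x (u s))}.
  apply: (@continuous_comp _ _ _ u ('D_w x)) => //.
  exact: smooth_continuous (smooth_derive w sx) Us.
have cc i : {for s, continuous (fun s => v s 0 i)}.
  apply: (@continuous_comp _ _ _ v (fun w : E2 => w 0 i)) => //.
  exact: coord_continuous.
by apply: cvgD; apply: cvgZ; [exact: cc|exact: cD|exact: cc|exact: cD].
Qed.

(* The Gram determinant of the partial derivatives of [x] is positive at [u0],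
   hence bounded below nearby; the constant [C] is a value of the quotient
   [num / gram] with some room added. *)
Lemma immersion_dominates U x xi u0 : open U -> U u0 ->
  smooth_on U x -> smooth_on U xi ->
  (forall v, 'D_v x u0 = 0 -> v = 0) ->
  exists C, \forall u \near u0, forall v,
    dot ('D_v xi u) ('D_v xi u) <= C * dot ('D_v x u) ('D_v x u).
Proof.
move=> oU Uu0 sx sxi imm.
pose A := 'D_(delta_mx 0 0) x; pose B := 'D_(delta_mx 0 1) x.
pose P := 'D_(delta_mx 0 0) xi; pose Q := 'D_(delta_mx 0 1) xi.
have cA : A @ u0 --> A u0 := smooth_continuous (smooth_derive _ sx) Uu0.
have cB : B @ u0 --> B u0 := smooth_continuous (smooth_derive _ sx) Uu0.
have cP : P @ u0 --> P u0 := smooth_continuous (smooth_derive _ sxi) Uu0.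
have cQ : Q @ u0 --> Q u0 := smooth_continuous (smooth_derive _ sxi) Uu0.
pose gram u := dot (A u) (A u) * dot (B u) (B u) - dot (A u) (B u) * dot (A u) (B u).
pose num u := 2 * (dot (P u) (P u) * dot (B u) (B u) + dot (Q u) (Q u) * dot (A u) (A u)).
have xE u v : U u -> 'D_v x u = v 0 0 *: A u + v 0 1 *: B u.
  by move=> Uu; exact/derive_plane/(smooth_differentiable sx).
have xiE u v : U u -> 'D_v xi u = v 0 0 *: P u + v 0 1 *: Q u.
  by move=> Uu; exact/derive_plane/(smooth_differentiable sxi).
have B0E : 'D_(delta_mx 0 1) x u0 = B u0 by [].
clearbody A B P Q.
have g0 : 0 < gram u0.
  have B0 : 0 < dot (B u0) (B u0).
    rewrite lt_def dot_ge0 andbT; apply/eqP => /dot_eq0.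
    rewrite -B0E => /imm/rowP/(_ 1).
    by rewrite !mxE/= => /eqP; rewrite oner_eq0.
  (* The derivative along [v] is, up to the factor [dot B B], the component of [A] orthogonal to
     [B]; its squared norm is [dot B B * gram]. It is nonzero because [x] is an immersion and the
     first entry of [v] is positive. *)
  pose v : E2 := \row_(i < 2) if i == 0 then dot (B u0) (B u0) else - dot (A u0) (B u0).
  have Wv : dot ('D_v x u0) ('D_v x u0) = dot (B u0) (B u0) * gram u0.
    rewrite xE// !mxE/= !(dotDl, dotDr, dotZl, dotZr) /gram.
    by rewrite (dotC (B u0) (A u0)); ring.
  rewrite -(pmulr_rgt0 _ B0) -Wv lt_def dot_ge0 andbT.
  apply/eqP => /dot_eq0/imm/rowP/(_ 0).
  by rewrite !mxE/= => /eqP; rewrite gt_eqF.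
pose C := (num u0 + 1) / gram u0; exists C.
have cgram : gram @ u0 --> gram u0.
  exact: cvgB (cvgM (cvg_dot _ cA cA) (cvg_dot _ cB cB))
    (cvgM (cvg_dot _ cA cB) (cvg_dot _ cA cB)).
have cnum : num @ u0 --> num u0.
  exact: cvgM (cvg_cst _) (cvgD (cvgM (cvg_dot _ cP cP) (cvg_dot _ cB cB))
    (cvgM (cvg_dot _ cQ cQ) (cvg_dot _ cA cA))).
have cC : (fun u => C * gram u - num u) @ u0 --> (1 : R).
  have -> : 1 = C * gram u0 - num u0.
    by rewrite /C mulfVK ?gt_eqF// addrAC subrr add0r.
  exact: cvgB (cvgM (cvg_cst _) cgram) cnum.
have n1 : \forall u \near u0, 0 < gram u by exact: (cvgr_gt _ cgram).
have n2 : \forall u \near u0, 0 < C * gram u - num u by exact: (cvgr_gt _ cC).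
have nU : \forall u \near u0, U u by exact: open_nbhs_nbhs.
apply: filterS3 nU n1 n2 => u Uu gu Cu v.
rewrite xE// xiE//.
set a := v 0 0; set b := v 0 1.
rewrite !(dotDl, dotDr, dotZl, dotZr) (dotC (B u) (A u)) (dotC (Q u) (P u)).
set AA := dot (A u) (A u); set BB := dot (B u) (B u); set AB := dot (A u) (B u).
set PP := dot (P u) (P u); set QQ := dot (Q u) (Q u); set PQ := dot (P u) (Q u).
have W0 : 0 <= a * (a * AA) + a * (b * AB) + (b * (a * AB) + b * (b * BB)).
  have := dot_ge0 (a *: A u + b *: B u).
  by rewrite !(dotDl, dotDr, dotZl, dotZr) (dotC (B u) (A u)) -/AA -/BB -/AB; lra.
have PQ0 : a * (a * PP) + a * (b * PQ) + (b * (a * PQ) + b * (b * QQ))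
    <= 2 * (a ^+ 2 * PP + b ^+ 2 * QQ).
  have := dot_ge0 (a *: P u + (- b) *: Q u).
  rewrite !(dotDl, dotDr, dotZl, dotZr) (dotC (Q u) (P u)) -/PP -/QQ -/PQ.
  by rewrite !expr2; lra.
rewrite -(ler_pM2l gu).
set W := a * (a * AA) + _ + _ in W0 *.
(* Completing the square: the squared coordinates of [v] are controlled by [W], the squared norm of
   the derivative of [x], divided by the Gram determinant. *)
have ga : a ^+ 2 * gram u <= BB * W.
  rewrite -subr_ge0 (_ : _ - _ = (a * AB + b * BB) ^+ 2) ?sqr_ge0//.
  by rewrite /W /gram -/AA -/BB -/AB; ring.
have gb : b ^+ 2 * gram u <= AA * W.
  rewrite -subr_ge0 (_ : _ - _ = (b * AB + a * AA) ^+ 2) ?sqr_ge0//.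
  by rewrite /W /gram -/AA -/BB -/AB; ring.
have PP0 : 0 <= PP := dot_ge0 _; have QQ0 : 0 <= QQ := dot_ge0 _.
apply: (@le_trans _ _ (num u * W)); last first.
  by rewrite mulrA (mulrC (gram u)) ler_wpM2r//; lra.
apply: (le_trans (ler_wpM2l (ltW gu) PQ0)).
have h1 := ler_wpM2l PP0 ga; have h2 := ler_wpM2l QQ0 gb.
have -> : gram u * (2 * (a ^+ 2 * PP + b ^+ 2 * QQ)) =
  2 * (PP * (a ^+ 2 * gram u) + QQ * (b ^+ 2 * gram u)) by ring.
have -> : num u * W = 2 * (PP * (BB * W) + QQ * (AA * W)).
  by rewrite /num -/AA -/BB -/PP -/QQ; ring.
by rewrite ler_wpM2l// lerD.
Qed.

End Plane.

(** * Velocities of curves read in charts *)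

Section Curves.
Variables (R : realType) (M : surface R).
Local Notation E3 := 'rV[R]_3.
Implicit Types (c : chart R M) (f x xi : M -> E3) (gamma : R -> M).

Lemma coord_dom c p : (par c @` dom c) p -> dom c (Defs.coord c p).
Proof. by move=> [u du <-]; rewrite parK. Qed.

Lemma coordK c p : (par c @` dom c) p -> par c (Defs.coord c p) = p.
Proof. by move=> [u du <-]; rewrite parK. Qed.

(** The open set hidden in [smooth_curve] is made explicit, so that pointwise statements can refer
    to it. *)
Definition smooth_curve_on (O : set R) gamma :=
  [/\ open O, (forall s, O s -> {for s, continuous gamma}) &
     forall c, atlas c -> @smooth_on R R 'rV[R]_2
       (O `&` gamma @^-1` (par c @` dom c)) (Defs.coord c \o gamma)].

(** Near [s] the curve stays in the chart, where [f \o gamma] factors through the plane and the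
    chain rule applies. *)
Lemma is_derive_along_curve f c O gamma s : smooth_field f -> atlas c ->
  smooth_curve_on O gamma -> O s -> (par c @` dom c) (gamma s) ->
  is_derive s (1 : R) (f \o gamma)
    ('D_('D_1 (Defs.coord c \o gamma) s) (f \o par c) (Defs.coord c (gamma s))).
Proof.
move=> sf ac [oO cg sg] Os cs.
have du : differentiable (Defs.coord c \o gamma) s.
  exact: smooth_differentiable (sg c ac) _.
have df : differentiable (f \o par c) ((Defs.coord c \o gamma) s).
  exact: smooth_differentiable (sf c ac) (coord_dom cs).
have near_s : \forall s' \near s, (par c @` dom c) (gamma s').
  exact: (cg s Os _ (open_nbhs_nbhs (conj (im_open c) cs))).
apply: (@near_eq_is_derive _ _ _ ((f \o par c) \o (Defs.coord c \o gamma))).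
  by apply: filterS near_s => s' cs'; rewrite /= coordK.
rewrite -derive_comp//.
by apply/derivableP/diff_derivable; exact: differentiable_comp.
Qed.

Lemma derivable_along_curve f O gamma s : smooth_field f ->
  smooth_curve_on O gamma -> O s -> derivable (f \o gamma) s 1.
Proof.
move=> sf sg Os; have [c ac cs] := atlas_cover (gamma s).
exact: (@ex_derive _ _ _ _ _ _ _ (is_derive_along_curve sf ac sg Os cs)).
Qed.

Lemma near_velocity f c O gamma s : smooth_field f -> atlas c ->
  smooth_curve_on O gamma -> O s -> (par c @` dom c) (gamma s) ->
  \forall s' \near s, derive1 (f \o gamma) s' =
    'D_('D_1 (Defs.coord c \o gamma) s') (f \o par c) (Defs.coord c (gamma s')).
Proof.
move=> sf ac sg Os cs; have [oO cg _] := sg.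
have near_s : \forall s' \near s, (par c @` dom c) (gamma s').
  exact: (cg s Os _ (open_nbhs_nbhs (conj (im_open c) cs))).
have nO : \forall s' \near s, O s' by exact: open_nbhs_nbhs.
apply: filterS2 nO near_s => s' Os' cs'; rewrite derive1E.
exact: (@derive_val _ _ _ _ _ _ _ (is_derive_along_curve sf ac sg Os' cs')).
Qed.

Lemma continuous_velocity f O gamma s : smooth_field f ->
  smooth_curve_on O gamma -> O s -> {for s, continuous (derive1 (f \o gamma))}.
Proof.
move=> sf sg Os; have [c ac cs] := atlas_cover (gamma s).
have [_ _ /(_ c ac) su] := sg.
have Us : (O `&` gamma @^-1` (par c @` dom c)) s by [].
apply: (@near_eq_continuous _ _ (fun s' =>
    'D_('D_1 (Defs.coord c \o gamma) s') (f \o par c) (Defs.coord c (gamma s')))).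
  by apply: filterS (near_velocity sf ac sg Os cs) => s' ->.
have cu := smooth_continuous su Us.
have cv := smooth_continuous (smooth_derive (1 : R) su) Us.
have := @continuous_derive_along R (dom c) (f \o par c) R (Defs.coord c \o gamma)
  ('D_1 (Defs.coord c \o gamma)) s (@dom_open _ _ c) (sf c ac) (coord_dom cs) cu cv.
exact.
Qed.

(** [immersion_dominates] gives a constant near each parameter, and compactness of the interval
    makes it uniform. Stating the bound for all large [K] lets the bounds for several fields be
    intersected. *)
Lemma velocity_dominated x xi O gamma (a b : R) : position_vector x ->
  smooth_field xi -> smooth_curve_on O gamma -> `[a, b] `<=` O ->
  \forall K \near +oo, forall s, a <= s <= b ->
    dot (derive1 (xi \o gamma) s) (derive1 (xi \o gamma) s) <=
    K * dot (derive1 (x \o gamma) s) (derive1 (x \o gamma) s).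
Proof.
move=> [sx imm] sxi sg abO.
have := (compact_near_coveringP _).1 (@segment_compact R a b) R (pinfty_nbhs R)
  (fun K s => dot (derive1 (xi \o gamma) s) (derive1 (xi \o gamma) s) <=
    K * dot (derive1 (x \o gamma) s) (derive1 (x \o gamma) s)) _.
move=> cover; have {cover} : \forall K \near +oo, `[a, b] `<=` (fun s =>
    dot (derive1 (xi \o gamma) s) (derive1 (xi \o gamma) s) <=
    K * dot (derive1 (x \o gamma) s) (derive1 (x \o gamma) s)).
  apply: cover => s /abO Os; have [c ac cs] := atlas_cover (gamma s).
  have [_ cg _] := sg.
  have [_ _ /(_ c ac) su] := sg.
  have Us : (O `&` gamma @^-1` (par c @` dom c)) s by [].
  have cu := smooth_continuous su Us.
  have [C HC] := immersion_dominates (@dom_open _ _ c) (coord_dom cs) (sx c ac)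
    (sxi c ac) (fun v => @imm c _ ac (coord_dom cs) v).
  have nC : \forall s' \near s, forall v,
    dot ('D_v (xi \o par c) (Defs.coord c (gamma s')))
        ('D_v (xi \o par c) (Defs.coord c (gamma s'))) <=
    C * dot ('D_v (x \o par c) (Defs.coord c (gamma s')))
            ('D_v (x \o par c) (Defs.coord c (gamma s'))).
    exact: (cu _ HC).
  have nK : \forall K \near +oo, C <= K by apply: nbhs_pinfty_ge; exact: num_real.
  have nx := near_velocity sx ac sg Os cs.
  have nxi := near_velocity sxi ac sg Os cs.
  exists ([set s' | [/\ (forall v,
    dot ('D_v (xi \o par c) (Defs.coord c (gamma s')))
        ('D_v (xi \o par c) (Defs.coord c (gamma s'))) <=
    C * dot ('D_v (x \o par c) (Defs.coord c (gamma s')))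
        ('D_v (x \o par c) (Defs.coord c (gamma s')))),
    derive1 (x \o gamma) s' =
      'D_('D_1 (Defs.coord c \o gamma) s') (x \o par c) (Defs.coord c (gamma s')) &
    derive1 (xi \o gamma) s' =
      'D_('D_1 (Defs.coord c \o gamma) s') (xi \o par c) (Defs.coord c (gamma s'))]],
    [set K | C <= K]).
    by split=> //; apply: filterS3 nC nx nxi.
  move=> [s' K] /= [[Cs' -> ->] CK].
  by apply: le_trans (Cs' _) _; rewrite ler_wpM2r ?dot_ge0.
by apply: filterS => K HK s sab; apply: HK; rewrite /= in_itv.
Qed.

End Curves.

(** * Flexes and quadratic forms *)

Section Flexes.
Variables (R : realType) (M : surface R).
Local Notation E3 := 'rV[R]_3.
Implicit Types (x xi : M -> E3) (gamma : R -> M).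

Lemma deformation1E x xi (t : R) :
  deformation x [tuple xi] t = fun p => x p + (2 * t) *: xi p.
Proof.
by apply/funext => p; rewrite /deformation big_ord_recl big_ord0 addr0 expr1.
Qed.

Lemma deformation2E x xi1 xi2 (t : R) :
  deformation x [tuple xi1; xi2] t =
  fun p => x p + ((2 * t) *: xi1 p + (2 * t ^+ 2) *: xi2 p).
Proof.
apply/funext => p.
by rewrite /deformation !big_ord_recl big_ord0 addr0 expr1.
Qed.

Lemma derive1D_scale (f g : R -> E3) k s : derivable f s 1 -> derivable g s 1 ->
  derive1 (fun s => f s + k *: g s) s = derive1 f s + k *: derive1 g s.
Proof.
move=> /derivableP df /derivableP dg; rewrite !derive1E.
exact: (@derive_val _ _ _ _ _ _ _ (is_deriveD df (is_deriveZ k dg))).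
Qed.

Lemma derive1D_scale2 (f g h : R -> E3) k l s :
  derivable f s 1 -> derivable g s 1 -> derivable h s 1 ->
  derive1 (fun s => f s + (k *: g s + l *: h s)) s =
  derive1 f s + (k *: derive1 g s + l *: derive1 h s).
Proof.
move=> /derivableP df /derivableP dg /derivableP dh; rewrite !derive1E.
exact: (@derive_val _ _ _ _ _ _ _
  (is_deriveD df (is_deriveD (is_deriveZ k dg) (is_deriveZ l dh)))).
Qed.

Lemma smooth_curveP (a b : R) gamma : smooth_curve a b gamma <->
  exists2 O, smooth_curve_on O gamma & `[a, b] `<=` O.
Proof.
split; last by case=> O [oO cg sg] abO; exists O.
by case=> O oO [abO [cg sg]]; exists O.
Qed.

(** At each parameter of a curve, the equations are used in some chart with [v] the coordinate
    velocity; they become the pointwise hypotheses of [second_order_length]. *)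
Lemma second_order_flex x xi1 xi2 : position_vector x ->
  smooth_field xi1 -> smooth_field xi2 ->
  (forall c u v, atlas c -> dom c u ->
    dot ('D_v (x \o par c) u) ('D_v (xi1 \o par c) u) = 0 /\
    dot ('D_v (xi1 \o par c) u) ('D_v (xi1 \o par c) u)
      + dot ('D_v (x \o par c) u) ('D_v (xi2 \o par c) u) = 0) ->
  flex x [tuple xi1; xi2].
Proof.
move=> px s1 s2 forms; split=> [i|a b gamma ab].
  by case: i => [[|[|//]] i2]; rewrite (tnth_nth xi1).
move=> /smooth_curveP[] O sg abO.
have sx : smooth_field x by case: px.
have abO' s : a <= s <= b -> O s by move=> sab; apply: abO; rewrite /= in_itv.
have vel t s : a <= s <= b ->
    derive1 (deformation x [tuple xi1; xi2] t \o gamma) s =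
    derive1 (x \o gamma) s + ((2 * t) *: derive1 (xi1 \o gamma) s
      + (2 * t ^+ 2) *: derive1 (xi2 \o gamma) s).
  move=> /abO' Os; rewrite deformation2E.
  by apply: derive1D_scale2; [exact: derivable_along_curve sx sg Os
    | exact: derivable_along_curve s1 sg Os | exact: derivable_along_curve s2 sg Os].
have [K HK1 HK2] : exists2 K,
  forall s, a <= s <= b ->
    dot (derive1 (xi1 \o gamma) s) (derive1 (xi1 \o gamma) s) <=
    K * dot (derive1 (x \o gamma) s) (derive1 (x \o gamma) s) &
  forall s, a <= s <= b ->
    dot (derive1 (xi2 \o gamma) s) (derive1 (xi2 \o gamma) s) <=
    K * dot (derive1 (x \o gamma) s) (derive1 (x \o gamma) s).
  have [K [HK1 HK2]] := filter_ex
    (filterI (velocity_dominated px s1 sg abO) (velocity_dominated px s2 sg abO)).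
  by exists K.
have lE : (fun t => curve_length a b (deformation x [tuple xi1; xi2] t \o gamma)
      - curve_length a b (x \o gamma)) =
    (fun t : R => \int[lebesgue_measure]_(s in `[a, b])
       enorm (derive1 (x \o gamma) s + ((2 * t) *: derive1 (xi1 \o gamma) s
          + (2 * t ^+ 2) *: derive1 (xi2 \o gamma) s))
     - \int[lebesgue_measure]_(s in `[a, b]) enorm (derive1 (x \o gamma) s)).
  apply/funext => t; congr (_ - _); apply: eq_Rintegral => s.
  by rewrite inE/= in_itv => sab; rewrite vel.
rewrite lE; apply: (@second_order_length _ _ _ K).
- by move=> s /abO' Os; split; [exact: continuous_velocity sx sg Os
    | exact: continuous_velocity s1 sg Os | exact: continuous_velocity s2 sg Os].
- move=> s /abO' Os; have [c ac cs] := atlas_cover (gamma s).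
  rewrite !derive1E.
  rewrite (@derive_val _ _ _ _ _ _ _ (is_derive_along_curve sx ac sg Os cs)).
  rewrite (@derive_val _ _ _ _ _ _ _ (is_derive_along_curve s1 ac sg Os cs)).
  rewrite (@derive_val _ _ _ _ _ _ _ (is_derive_along_curve s2 ac sg Os cs)).
  exact/forms/coord_dom.
- by move=> s sab; split; [exact: HK1|exact: HK2].
Qed.

Lemma is_diff_line (u v : 'rV[R]_2) (s : R) :
  is_diff s (fun s : R => u + s *: v) (fun s => s *: v).
Proof.
have dv : is_diff s ( *:%R ^~ v) ( *:%R ^~ v) by exact: is_diff_scalel.
have -> : (fun s : R => s *: v) = (0 : R -> 'rV[R]_2) + ( *:%R ^~ v).
  by apply/funext => r; rewrite fctE/= add0r.
have -> : (fun s : R => u + s *: v) = cst u + ( *:%R ^~ v) by apply/funext => r.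
exact: is_diffD.
Qed.

(** In another chart the segment is a transition map composed with an affine line. *)
Lemma line_smooth_curve_on (c : chart R M) (u v : 'rV[R]_2) : atlas c ->
  smooth_curve_on [set s : R | dom c (u + s *: v)] (fun s => par c (u + s *: v)).
Proof.
move=> ac; have dl := is_diff_line u v.
have cl : continuous (fun s : R => u + s *: v).
  by move=> s; exact/differentiable_continuous/ex_diff.
split.
- by apply: (@open_comp _ _ (fun s : R => u + s *: v)) => //; exact: dom_open.
- move=> s dus; apply: (@continuous_comp _ _ _ (fun s : R => u + s *: v) (par c)).
    exact: cl.
  exact: par_continuous.
- move=> d ad k.
  apply: (@Ck_comp_affine _ _ _ _ k (dom c `&` par c @^-1` (par d @` dom d))
    (Defs.coord d \o par c) (fun s : R => u + s *: v) (fun s => s *: v)) => //.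
    apply: open_setI_preimage; [exact: dom_open|exact: im_open|].
    exact: par_continuous.
  exact: atlas_smooth.
Qed.

Lemma derive_line (f : M -> E3) (c : chart R M) (u v : 'rV[R]_2) (s : R) :
  smooth_field f -> atlas c -> dom c (u + s *: v) ->
  derive1 (f \o (fun s => par c (u + s *: v))) s = 'D_v (f \o par c) (u + s *: v).
Proof.
move=> sf ac dus; have dl := is_diff_line u v s; rewrite derive1E.
have lv : 'D_1 (fun s : R => u + s *: v) s = v.
  by rewrite deriveE ?diff_val ?scale1r//; exact: ex_diff.
have df := smooth_differentiable (sf c ac) dus.
have := @derive_comp _ _ _ _ (fun s : R => u + s *: v) (f \o par c) s 1
  (@ex_diff _ _ _ _ _ _ _ dl) df.
by rewrite lv.
Qed.

(** The flex is tested on short chart segments issuing from [u] in direction [v], whose initial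
    velocities in space are the derivatives along [v]. *)
Lemma first_order_flex_form x xi (c : chart R M) (u v : 'rV[R]_2) :
  smooth_field x -> flex x [tuple xi] -> atlas c -> dom c u ->
  dot ('D_v (x \o par c) u) ('D_v (xi \o par c) u) = 0.
Proof.
move=> sx [/(_ ord0) sxi fl] ac du; rewrite (tnth_nth xi)/= in sxi.
pose gamma (s : R) := par c (u + s *: v).
pose O := [set s : R | dom c (u + s *: v)].
have sg : smooth_curve_on O gamma := line_smooth_curve_on u v ac.
have O0 : O 0 by rewrite /O/= scale0r addr0.
have [r /= r0 Hr] : nbhs_ball (0 : R) O.
  by apply/nbhs_ballP; apply: open_nbhs_nbhs; split=> //; case: sg.
have d0 : 0 < r / 2 by rewrite divr_gt0.
have dO s : 0 <= s <= r / 2 -> O s.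
  move=> /andP[s0 sr]; apply: Hr; rewrite -ball_normE/= sub0r normrN ger0_norm//.
  by apply: le_lt_trans sr _; rewrite ltr_pdivrMr// ltr_pMr// ltr1n.
have := @first_order_length R (r / 2) (derive1 (x \o gamma)) (derive1 (xi \o gamma)) d0.
rewrite /gamma !derive_line ?scale0r ?addr0//; apply.
- move=> s /dO Os; split; [exact: continuous_velocity sx sg Os
    | exact: continuous_velocity sxi sg Os].
- move=> e /andP[e0 er].
  have eO s : 0 <= s <= e -> O s.
    by move=> /andP[s0 se]; apply: dO; rewrite s0 (le_trans se).
  have eO' : `[0, e] `<=` O by move=> s /=; rewrite in_itv; exact: eO.
  have sge : smooth_curve 0 e gamma by apply/smooth_curveP; exists O.
  have := fl 0 e gamma (ltW e0) sge.
  have -> // : (fun t => curve_length 0 e (deformation x [tuple xi] t \o gamma)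
      - curve_length 0 e (x \o gamma)) =
    (fun t : R => \int[lebesgue_measure]_(s in `[0, e])
       enorm (derive1 (x \o gamma) s + (2 * t) *: derive1 (xi \o gamma) s)
     - \int[lebesgue_measure]_(s in `[0, e]) enorm (derive1 (x \o gamma) s)).
  apply/funext => t; congr (_ - _); apply: eq_Rintegral => s.
  rewrite inE/= in_itv => /eO Os; congr enorm.
  rewrite deformation1E.
  by apply: derive1D_scale; [exact: derivable_along_curve sx sg Os
    | exact: derivable_along_curve sxi sg Os].
Qed.

End Flexes.

(** * Families of surfaces *)

Lemma smooth_derive_comm (R : realType) (E : normedModType R) n
    (W : set E) (f : E -> 'rV[R]_n.+1) p v w :
  open W -> smooth_on W f -> W p ->
  'D_v ('D_w f) p = 'D_w ('D_v f) p.
Proof.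
move=> oW sf Wp.
have d1 u q : W q -> is_derive q u f ('D_u f q).
  by move=> Wq; exact/derivableP/diff_derivable/(smooth_differentiable sf).
have d2 u u' q : W q -> is_derive q u ('D_u' f) ('D_u ('D_u' f) q).
  move=> Wq; apply/derivableP/diff_derivable.
  exact/(smooth_differentiable (smooth_derive u' sf)).
have c2 u u' i : {for p, continuous (fun q => 'D_u ('D_u' f) q 0 i)}.
  apply: (@continuous_comp _ _ _ ('D_u ('D_u' f)) (fun N : 'rV[R]_n.+1 => N 0 i)).
    exact: smooth_continuous (smooth_derive u (smooth_derive u' sf)) Wp.
  exact: coord_continuous.
have nW : \forall q \near p, W q by exact: open_nbhs_nbhs.
apply/rowP => i.
apply: (@mixed_derivative_eq R E (fun q => f q 0 i) (fun q => 'D_v f q 0 i)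
  (fun q => 'D_w f q 0 i) (fun q => 'D_v ('D_w f) q 0 i)
  (fun q => 'D_w ('D_v f) q 0 i) p v w) => //.
  by apply: filterS nW => q Wq; split; apply: is_derive_coord; exact: d1.
by apply: filterS nW => q Wq; split; apply: is_derive_coord; exact: d2.
Qed.

Section Families.
Variables (R : realType) (M : surface R).
Local Notation E2 := 'rV[R]_2.
Local Notation E3 := 'rV[R]_3.
Implicit Types (Y : R -> M -> E3) (c : chart R M).

(** As a single map on the product, the family has its parameter derivative and its surface
    derivatives as directional derivatives along [(k, 0)] and [(0, v)]; exchanging them is then
    symmetry of second derivatives. *)
Definition chart_family Y c (z : R * E2) : E3 := Y z.1 (par c z.2).

Definition family_domain c : set (R * E2) := `]-1, 1[ `*` dom c.

Lemma open_family_domain c : open (family_domain c).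
Proof.
rewrite (_ : family_domain c = fst @^-1` `]-1, 1[ `&` snd @^-1` dom c)//.
apply: openI; apply: open_comp => //.
- by move=> z _; exact: cvg_fst.
- by move=> z _; exact: cvg_snd.
- exact: dom_open.
Qed.

Lemma family_domain0 c u : dom c u -> family_domain c (0, u).
Proof. by move=> du; split; rewrite //= in_itv/= oppr_lt0 ltr01. Qed.

Lemma is_diff_pairl (u : E2) (r : R) :
  is_diff r (fun r : R => (r, u)) (fun k => (k, 0)).
Proof. exact: (@is_diff_pair _ _ _ _ id id (cst u) 0 r _ _). Qed.

Lemma is_diff_pairr (r : R) (u : E2) :
  is_diff u (fun u : E2 => (r, u)) (fun v => (0, v)).
Proof. exact: (@is_diff_pair _ _ _ _ (cst r) 0 id id u _ _). Qed.

Lemma derive_family_l (f : R * E2 -> E3) r u k : differentiable f (r, u) ->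
  is_derive r k (fun r => f (r, u)) ('D_(k, 0) f (r, u)).
Proof.
move=> df; have dp := is_diff_pairl u r.
have dfp : differentiable (f \o (fun r : R => (r, u))) r.
  by apply: differentiable_comp => //; exact: ex_diff.
split; first exact: diff_derivable.
have gk : 'D_k (fun r : R => (r, u)) r = (k, 0).
  by rewrite deriveE ?diff_val//; exact: ex_diff.
rewrite -gk; apply: derive_comp => //; exact: ex_diff.
Qed.

Lemma derive_family_r (f : R * E2 -> E3) r u v : differentiable f (r, u) ->
  'D_v (fun u => f (r, u)) u = 'D_(0, v) f (r, u).
Proof.
move=> df; have dp := is_diff_pairr r u.
have gv : 'D_v (fun u : E2 => (r, u)) u = (0, v).
  by rewrite deriveE ?diff_val//; exact: ex_diff.
rewrite -gv; apply: derive_comp => //; exact: ex_diff.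
Qed.

(* The direction [k] rather than [1] absorbs the factors 2 of the deformations. *)
Definition initial_derivative k Y (p : M) : E3 := 'D_k (fun r => Y r p) 0.

Lemma initial_derivative_chart k Y c u : smooth_family Y -> atlas c -> dom c u ->
  initial_derivative k Y (par c u) = 'D_(k, 0) (chart_family Y c) (0, u).
Proof.
move=> sY ac du.
have df : differentiable (chart_family Y c) (0, u).
  exact: smooth_differentiable (sY c ac) (family_domain0 du).
exact: (@derive_val _ _ _ _ _ _ _ (derive_family_l k df)).
Qed.

(** In a chart this is a derivative of the joint map restricted to the slice over 0, which is an
    affine embedding. *)
Lemma smooth_initial_derivative k Y : smooth_family Y -> smooth_field (initial_derivative k Y).
Proof.
move=> sY c ac n.
apply: (@eq_Ck _ _ _ n (dom c) ('D_(k, 0) (chart_family Y c) \o (fun u => (0, u)))).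
- exact: dom_open.
- by move=> u; rewrite inE => du /=; rewrite initial_derivative_chart.
- apply: (@sub_Ck _ _ _ n ((fun u => (0, u)) @^-1` family_domain c)).
    by move=> u du; exact: family_domain0.
  apply: Ck_comp_affine (fun u => is_diff_pairr 0 u) _.
    exact: open_family_domain.
  exact: (smooth_derive (k, 0) (sY c ac)).
Qed.

Lemma is_derive_family k Y c u v : smooth_family Y -> atlas c -> dom c u ->
  is_derive (0 : R) k (fun r => 'D_v (Y r \o par c) u)
    ('D_v (initial_derivative k Y \o par c) u).
Proof.
move=> sY ac du; have sF := sY c ac.
have F0 := family_domain0 du.
have oc := @open_family_domain c.
have near0 : \forall r \near (0 : R), family_domain c (r, u).
  have cp : {for 0, continuous (fun r : R => (r, u))}.
    by have dp := is_diff_pairl u 0; exact/differentiable_continuous/ex_diff.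
  exact: (cp _ (open_nbhs_nbhs (conj oc F0))).
have nu : \forall u' \near u, dom c u'.
  by apply: open_nbhs_nbhs; split=> //; exact: dom_open.
apply: (@near_eq_is_derive _ _ _ (fun r => 'D_(0, v) (chart_family Y c) (r, u))).
  apply: filterS near0 => r Wr; rewrite -derive_family_r//.
  exact: smooth_differentiable sF Wr.
(* The order of the derivatives along [(k, 0)] and [(0, v)] is exchanged here. *)
have -> : 'D_v (initial_derivative k Y \o par c) u =
    'D_(k, 0) ('D_(0, v) (chart_family Y c)) (0, u).
  rewrite (smooth_derive_comm _ _ oc sF F0) -derive_family_r; last first.
    exact: smooth_differentiable (smooth_derive _ sF) F0.
  apply: near_eq_derive.
  by apply: filterS nu => u' du'; rewrite /= initial_derivative_chart.
apply: derive_family_l.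
exact: smooth_differentiable (smooth_derive _ sF) F0.
Qed.

End Families.

(** * Extension of a tangent flex to second order *)

Theorem theorem1 (R : realType) (M : surface R) (x xi1 : M -> 'rV[R]_3)
  (hx : position_vector x)
  (hflex : flex x [tuple xi1])
  (htangent : tangent_to_nonrigid x xi1) :
  exists xi2 : M -> 'rV[R]_3,
    smooth_field xi2 /\ flex x [tuple xi1; xi2].
Proof.
case: htangent => X [Xi [[sX pX X0] [sXi fXi dX Xi0]]].
have s1 : smooth_field xi1 by have := hflex.1 ord0; rewrite (tnth_nth xi1).
have s2 := smooth_initial_derivative 2^-1 sXi.
exists (initial_derivative 2^-1 Xi); split=> //.
apply: second_order_flex => // c u v ac du.
have form r : r \in `]-1, 1[ ->
    dot ('D_v (X r \o par c) u) ('D_v (Xi r \o par c) u) = 0.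
  move=> r1; apply: first_order_flex_form (fXi r r1) ac du.
  by case: (pX r r1) => -[].
split; first by have := form 0; rewrite X0 Xi0 in_itv/= oppr_lt0 ltr01; apply.
(* Linearity in the direction: half of the initial velocity [2 *: xi1] of the family. *)
have varX : initial_derivative 2^-1 X = xi1.
  apply/funext => p; have [dXp dXE] := dX p.
  have dfp : differentiable (fun r => X r p) 0 by exact/derivable1_diffP.
  rewrite /initial_derivative deriveE// -[2^-1]mulr1 [_ * 1](_ : _ = 2^-1 *: (1 : R))//.
  by rewrite linearZ/= -deriveE// dXE Xi0 scalerA mulVf ?scale1r// pnatr_eq0.
have := is_derive_dot (is_derive_family 2^-1 v sX ac du)
  (is_derive_family 2^-1 v sXi ac du).
rewrite varX X0 Xi0 => -[_ <-].
(* The product rule has turned the second-order expression into the derivative at 0 of the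
   first-order forms of the family. These vanish for [r] in the open interval, so the derivative is
   that of the constant 0. *)
rewrite -[RHS](@derive_cst _ _ _ (0 : R) (0 : R) 2^-1); apply: near_eq_derive.
have itv0 : \forall r \near (0 : R), r \in `]-1, 1[.
  by apply: near_in_itvoo; rewrite in_itv/= oppr_lt0 ltr01.
by apply: filterS itv0 => r /form.
Qed.
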